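(* Let $n\ge1$, $h>0$, $\mathbf a\in C\ell_{0,n}$, and let $\kappa(t)=\sum_{k\ge0}a_k\frac{t^k}{k!}$ be a real formal power series with $\kappa(0)\ne0$. Let $\lambda(y)$ ($y\in\mathbb R^n$) be a multi-variable function (regarded as a formal power series in $y_1,\dots,y_n$) satisfying $$\lambda\left(\frac{D_h^+\exp(x\cdot y)}{\exp(x\cdot y)}\right)=\prod_{j=1}^n\kappa(y_j),$$ and let $\Lambda_h=X_h-[\log\lambda(D_h^+),X_h]$ be the corresponding Fischer dual of $D_h^+$. Let $\sigma(D_h^+)\in\mathrm{End}(\mathcal P)$ be the operator obtained from $\lambda\left(\exp(-x\cdot y)\,D_h^+\exp(x\cdot y)\right)$ by the substitution $y_j\to\partial_{x_j}$, $j=1,\dots,n$. Then $$\Lambda_h=\sigma(D_h^+)^{-1}\,X_h\,\sigma(D_h^+).$$ Moreover, for every $k\in\mathbb N_0$, the Clifford-vector-valued polynomials $\mathbf w_k(x;h;\lambda)=\mu_k(\Lambda_h)^k\mathbf a$ and $\mathbf w_k(x;h)=\mu_k(X_h)^k\mathbf a$ are related by $$\mathbf w_k(x;h;\lambda)=\lambda(\mathbf 0)\,\sigma(D_h^+)^{-1}\left[\mathbf w_k(x;h)\right].$$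
   Context: $C\ell_{0,n}$ is the real Clifford algebra generated by $\mathbf{e}_1,\ldots,\mathbf{e}_n$ with $\mathbf{e}_j\mathbf{e}_k+\mathbf{e}_k\mathbf{e}_j=-2\delta_{jk}$. Vectors of $\mathbb{R}^n$ are written $x=\sum_j x_j\mathbf{e}_j$, and $x\cdot y=\sum_{j}x_jy_j$. $\mathcal{P}=\mathbb{R}[x]\otimes C\ell_{0,n}$ is the space of $C\ell_{0,n}$-valued polynomials in $x_1,\dots,x_n$; elements of $C\ell_{0,n}$ act on $\mathcal P$ by left multiplication and $[A,B]=AB-BA$ in $\mathrm{End}(\mathcal P)$. Operators on $\mathcal P$: $(\partial_h^{+j}\mathbf f)(x)=\frac{\mathbf f(x+h\mathbf e_j)-\mathbf f(x)}{h}$; $D_h^+=\sum_{j=1}^n\mathbf e_j\partial_h^{+j}$; $(X_h\mathbf f)(x)=\sum_{j=1}^n\mathbf e_j x_j\mathbf f(x-h\mathbf e_j)$. A formal power series in commuting operators that lower polynomial degree (such as $\partial_{x_j}$ or $\partial_h^{+j}$) acts on $\mathcal P$ because only finitely many terms act non-trivially on a given polynomial. Note that $\frac{D_h^+\exp(x\cdot y)}{\exp(x\cdot y)}=\sum_{j=1}^n\mathbf e_j\frac{\exp(hy_j)-1}{h}$, so the hypothesis on $\lambda$ is an identity of formal power series in $y_1,\ldots,y_n$. For a formal power series $g(y)$ in $y_1,\ldots,y_n$, $g(D_h^+)$ (for $g=\log\lambda$) denotes the scalar operator obtained by substituting $y_j\to\partial_h^{+j}$ in $g(y)$. Here $\log\lambda$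 is a formal power series with $\partial_{y_j}(\log\lambda)=(\partial_{y_j}\lambda)/\lambda$ for all $j$; its additive constant is irrelevant since only a commutator is taken. The constants $\mu_k\in\mathbb R$ ($k\in\mathbb N_0$) do not depend on $\lambda$; they are those fixed by the normalization $\mathbf w_0=\mathbf a$ (so $\mu_0=1$) and by the Appell property $D_h^+\mathbf w_k=k\,\mathbf w_{k-1}$ for $k\ge1$, where $\mathbf w_k$ denotes $\mathbf w_k(x;h;\lambda)$; $\mathbf w_k(x;h)$ is the case $\lambda\equiv1$. *)

(* Defs.v *)
From HB Require Import structures.
From mathcomp Require Import all_boot all_order all_algebra.
From mathcomp Require Import reals mpoly.

Set Implicit Arguments.
Unset Strict Implicit.
Unset Printing Implicit Defensive.

Import Order.TTheory GRing.Theory Num.Theory.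
Local Open Scope ring_scope.

(** * The Clifford algebra of signature (0, n)

    An element is given by its coordinates on the basis e_A, A a subset of
    {0, .., n-1}, where e_A = e_i1 e_i2 .. e_ik for A = {i1 < i2 < .. < ik}. *)

Definition clifford (R : comNzRingType) (n : nat) := {ffun {set 'I_n} -> R^o}.

Section SymDiff.
Variable T : finType.

Definition setSD (A B : {set T}) : {set T} := [set x | (x \in A) (+) (x \in B)].

Lemma setSDA A B C : setSD A (setSD B C) = setSD (setSD A B) C.
Proof. by apply/setP => x; rewrite !inE addbA. Qed.

Lemma setSDC A B : setSD A B = setSD B A.
Proof. by apply/setP => x; rewrite !inE addbC. Qed.

Lemma setSD0 A : setSD A set0 = A.
Proof. by apply/setP => x; rewrite !inE addbF. Qed.

Lemma set0SD A : setSD set0 A = A.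
Proof. by rewrite setSDC setSD0. Qed.

Lemma setSDv A : setSD A A = set0.
Proof. by apply/setP => x; rewrite !inE addbb. Qed.

Lemma setSDK A : involutive (setSD A).
Proof. by move=> B; rewrite setSDA setSDv set0SD. Qed.

End SymDiff.

Section Clifford.
Variables (R : comNzRingType) (n : nat).
Implicit Types (A B C : {set 'I_n}) (u v w : clifford R n).

HB.instance Definition _ := GRing.Lmodule.on (clifford R n).

(* e_A * e_B = cl_sign A B *: e_(A symdiff B): each pair i in A, j in B
   contributes a sign if j < i (anticommutation) or j = i (e_i ^+ 2 = -1). *)
Definition cl_sign A B : R := \prod_(i in A) \prod_(j in B | (j <= i)%N) -1.

Definition cl_basis A : clifford R n := [ffun B => (A == B)%:R].

(* the pairs (A, B) with A symdiff B = C are the pairs (A, setSD A C) *)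
Definition cl_mul u v : clifford R n :=
  [ffun C => \sum_A cl_sign A (setSD A C) * (u A * v (setSD A C))].

Definition cl_gen (j : 'I_n) : clifford R n := cl_basis [set j].

Lemma prod_setSD (F : 'I_n -> R) A B : (forall i, F i * F i = 1) ->
  \prod_(i in setSD A B) F i = (\prod_(i in A) F i) * (\prod_(i in B) F i).
Proof.
move=> FF; rewrite big_mkcond [\prod_(i in A) _]big_mkcond.
rewrite [\prod_(i in B) _]big_mkcond -big_split; apply: eq_bigr => i _.
by rewrite inE; case: (i \in A); case: (i \in B); rewrite /= ?mulr1 ?mul1r.
Qed.

Lemma cl_sign_sq A B : cl_sign A B * cl_sign A B = 1.
Proof.
rewrite -big_split big1 //= => i _; rewrite -big_split big1 //= => j _.
by rewrite mulrNN mulr1.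
Qed.

Lemma cl_signDl A B C : cl_sign (setSD A B) C = cl_sign A C * cl_sign B C.
Proof.
apply: prod_setSD => i; rewrite -big_split big1 //= => j _.
by rewrite mulrNN mulr1.
Qed.

Lemma cl_signDr A B C : cl_sign A (setSD B C) = cl_sign A B * cl_sign A C.
Proof.
rewrite -big_split; apply: eq_bigr => i _ /=; rewrite !big_mkcondr.
by apply: prod_setSD => j; case: leqP; rewrite ?mulrNN mulr1.
Qed.

Lemma cl_sign0l A : cl_sign set0 A = 1.
Proof. by rewrite /cl_sign big_set0. Qed.

Lemma cl_sign0r A : cl_sign A set0 = 1.
Proof. by rewrite /cl_sign big1 // => i _; rewrite big_pred0 // => j; rewrite inE. Qed.

Lemma cl_mulA : associative cl_mul.
Proof.
move=> u v w; apply/ffunP => D; rewrite !ffunE.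
under [LHS]eq_bigr => A _ do rewrite ffunE 2!mulr_sumr.
under [RHS]eq_bigr => C _ do rewrite ffunE mulr_suml mulr_sumr.
rewrite [RHS]exchange_big /=; apply: eq_bigr => A _.
rewrite [RHS](reindex_inj (inv_inj (setSDK A))) /=.
apply: eq_bigr => B _; rewrite setSDK.
have -> : setSD B (setSD A D) = setSD (setSD A B) D.
  by rewrite setSDA (setSDC B).
set E := setSD (setSD A B) D.
have -> : setSD A D = setSD B E.
  by rewrite /E setSDA (setSDC A B) setSDK.
rewrite cl_signDl cl_signDr.
by rewrite !mulrA (mulrAC _ (u A)) -(mulrA (cl_sign A B)) (mulrC (cl_sign A B)).
Qed.

Lemma cl_mul1l : left_id (cl_basis set0) cl_mul.
Proof.
move=> u; apply/ffunP => C; rewrite ffunE (bigD1 set0) //= big1 => [|A nA].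
  by rewrite ffunE eqxx set0SD cl_sign0l !mul1r addr0.
by rewrite ffunE eq_sym (negbTE nA) mul0r mulr0.
Qed.

Lemma cl_mul1r : right_id (cl_basis set0) cl_mul.
Proof.
move=> u; apply/ffunP => C; rewrite ffunE (bigD1 C) //= big1 => [|A nA].
  by rewrite ffunE setSDv eqxx cl_sign0r mul1r mulr1 addr0.
rewrite ffunE; case: eqP => [E|_]; last by rewrite !mulr0.
by move: nA; rewrite -(setSDK A C) -E setSD0 eqxx.
Qed.

Lemma cl_mulDl : left_distributive cl_mul +%R.
Proof.
move=> u v w; apply/ffunP => C; rewrite !ffunE -big_split.
by apply: eq_bigr => A _; rewrite ffunE mulrDl mulrDr.
Qed.

Lemma cl_mulDr : right_distributive cl_mul +%R.
Proof.
move=> u v w; apply/ffunP => C; rewrite !ffunE -big_split.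
by apply: eq_bigr => A _; rewrite ffunE !mulrDr.
Qed.

Lemma cl_basis0_neq0 : cl_basis set0 != 0.
Proof. by apply/eqP => /ffunP/(_ set0)/eqP; rewrite !ffunE eqxx oner_eq0. Qed.

HB.instance Definition _ := GRing.Zmodule_isNzRing.Build (clifford R n)
  cl_mulA cl_mul1l cl_mul1r cl_mulDl cl_mulDr cl_basis0_neq0.

Lemma cl_scaleAl (c : R) u v : c *: (u * v) = (c *: u) * v.
Proof.
apply/ffunP => C; rewrite !ffunE scaler_sumr; apply: eq_bigr => A _.
by rewrite ffunE -mulrA [RHS]mulrCA.
Qed.

Lemma cl_scaleAr (c : R) u v : c *: (u * v) = u * (c *: v).
Proof.
apply/ffunP => C; rewrite !ffunE scaler_sumr; apply: eq_bigr => A _.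
by rewrite ffunE (mulrCA (u A)) [RHS]mulrCA.
Qed.

HB.instance Definition _ :=
  GRing.Lmodule_isLalgebra.Build R (clifford R n) cl_scaleAl.
HB.instance Definition _ :=
  GRing.Lalgebra_isAlgebra.Build R (clifford R n) cl_scaleAr.

Definition cl_real (c : R) : clifford R n := c%:A.

Lemma cl_mul_basis A B :
  cl_basis A * cl_basis B = cl_sign A B *: cl_basis (setSD A B).
Proof.
apply/ffunP => C; rewrite !ffunE (bigD1 A) //= big1 => [|D nD].
  rewrite !ffunE eqxx mul1r addr0 -[in RHS](inj_eq (inv_inj (setSDK A))) setSDK.
  by case: eqP => [->|_] //; rewrite mulr0 scaler0.
by rewrite ffunE eq_sym (negbTE nD) mul0r mulr0.
Qed.

Lemma cl_gen_rel (j k : 'I_n) :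
  cl_gen j * cl_gen k + cl_gen k * cl_gen j = (- 2 * (j == k)%:R)%:A.
Proof.
have sE (i l : 'I_n) : cl_sign [set i] [set l] = if (l <= i)%N then -1 else 1.
  by rewrite /cl_sign big_set1 big_mkcondr big_set1.
rewrite /cl_gen !cl_mul_basis !sE (setSDC [set k]); case: eqVneq => [->|njk].
  rewrite leqnn setSDv -scalerDl mulr1 -opprD.
  by [].
rewrite mulr0 scale0r -scalerDl; case: ltngtP => [||/val_inj] /=.
- by rewrite addNr scale0r.
- by rewrite addrN scale0r.
- by move=> Ejk; rewrite Ejk eqxx in njk.
Qed.

(* cl_basis A is the product of the generators indexed by A, in increasing
   order; in particular the generators generate the algebra. *)
Lemma cl_basis_prod A : cl_basis A = \prod_(j in A) cl_gen j.
Proof.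
have sE (s : seq 'I_n) : sorted ltn (map val s) ->
    cl_basis [set:: s] = \prod_(j <- s) cl_gen j.
  elim: s => [_|i s IHs /=]; first by rewrite big_nil; congr cl_basis; apply/setP => x; rewrite !inE.
  move=> pis; rewrite big_cons -IHs ?(path_sorted pis) // cl_mul_basis.
  have lti j : j \in s -> (i < j)%N.
    move=> js; have /= /allP := order_path_min ltn_trans pis; apply.
    exact: map_f.
  have -> : cl_sign [set i] [set:: s] = 1.
    rewrite /cl_sign big_set1 big_pred0 // => j; rewrite inE.
    by apply/negP => /andP[/lti lij]; rewrite leqNgt lij.
  rewrite scale1r; congr cl_basis; apply/setP => x; rewrite !inE.
  case: eqVneq => [->|] //=; case si: (i \in s) => //=.
  by have := lti _ si; rewrite ltnn.
rewrite -big_filter deprecated_filter_index_enum -sE.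
  by congr cl_basis; apply/setP => x; rewrite inE mem_enum.
rewrite sorted_map {1}/enum_mem -enumT.
apply: sorted_filter; first by move=> x y z; apply: ltn_trans.
by rewrite -sorted_map val_enum_ord iota_ltn_sorted.
Qed.

End Clifford.

(** * Formal power series in y_0, .., y_(n-1)

    [g m] is the coefficient of y^m, with y^m = \prod_j y_j ^+ m j. *)

Definition fps (R : realType) (n : nat) := 'X_{1..n} -> R.

Section FormalPowerSeries.
Variables (R : realType) (n : nat).
Implicit Types (g u : fps R n) (m : 'X_{1..n}).

Definition fps_one : fps R n := fun m => (m == 0%MM)%:R.

(* (k <= m)%MM is the componentwise order *)
Definition fps_mul g u : fps R n := fun m =>
  \sum_(k : 'X_{1..n < (mdeg m).+1} | (k <= m)%MM) g k * u (m - k)%MM.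

Definition fps_exp g (k : nat) : fps R n := iter k (fps_mul g) fps_one.

Definition fps_deriv (j : 'I_n) g : fps R n :=
  fun m => (m j).+1%:R * g (m + U_(j))%MM.

(* g (v 0, .., v (n-1)). Only meaningful when every v j has constant term 0:
   then the terms of g of degree > mdeg m do not contribute to y^m. *)
Definition fps_comp g (v : 'I_n -> fps R n) : fps R n := fun m =>
  \sum_(k : 'X_{1..n < (mdeg m).+1})
     g k * (\big[fps_mul/fps_one]_(j < n) fps_exp (v j) (k j)) m.

(* s(y_j), for the one-variable series s(t) = \sum_k s k * t^k *)
Definition fps_var (j : 'I_n) (s : nat -> R) : fps R n :=
  fun m => if m == (U_(j) *+ m j)%MM then s (m j) else 0.

(* the one-variable series \sum_k c k * t^k / k! *)
Definition egf (c : nat -> R) : nat -> R := fun k => c k / k`!%:R.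

(* (exp(h y_j) - 1) / h, the coordinate on e_j of the Clifford vector
   exp(- x.y) D_h^+ exp(x.y) *)
Definition fdiff_symbol (h : R) (j : 'I_n) : fps R n :=
  fps_var j (fun k => (egf (GRing.exp h) k - (k == 0)%:R) / h).

(* L is a logarithm of g: d_j L = (d_j g) / g for all j *)
Definition is_fps_log g (L : fps R n) : Prop :=
  forall j, fps_mul g (fps_deriv j L) =1 fps_deriv j g.

End FormalPowerSeries.

(** * Operators on Clifford-valued polynomials

    In [{mpoly (clifford R n)[n]}] the variables commute with the
    coefficients, and [*:] is left multiplication by Clifford numbers. *)

Section Operators.
Variables (R : realType) (n : nat).
Local Notation P := {mpoly (clifford R n)[n]}.
Implicit Types (f : P) (A B : P -> P) (h : R) (j : 'I_n).

Definition real_scale (c : R) f : P := cl_real n c *: f.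

(* f(x + c e_j) *)
Definition translate (c : R) j f : P :=
  f \mPo [tuple 'X_i + (if i == j then cl_real n c else 0)%:MP | i < n].

Definition fdiff h j f : P := real_scale h^-1 (translate h j f - f).

Definition dirac_fdiff h f : P := \sum_(j < n) cl_gen R j *: fdiff h j f.

Definition X_op h f : P :=
  \sum_(j < n) cl_gen R j *: ('X_j * translate (- h) j f).

Definition commutator A B f : P := A (B f) - B (A f).

(* The operator g(T_0, .., T_(n-1)), for commuting T_j lowering the degree:
   the monomials in the T_j of degree >= msize f kill f. *)
Definition fps_op (T : 'I_n -> P -> P) (g : fps R n) f : P :=
  \sum_(m : 'X_{1..n < msize f})
     real_scale (g m) ((\big[comp/id]_(j < n) iter (m j) (T j)) f).

(* Lambda_h, with L = log lambda *)
Definition fischer_dual h (L : fps R n) f : P :=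
  X_op h f - commutator (fps_op (fdiff h) L) (X_op h) f.

Definition sigma_op h (lambda : fps R n) : P -> P :=
  fps_op (fun j => mderiv j) (fps_comp lambda (fdiff_symbol h)).

(* mu_k A^k a, for the constant polynomial a *)
Definition power_poly (mu : nat -> R) A (a : clifford R n) (k : nat) : P :=
  real_scale (mu k) (iter k A a%:MP).

End Operators.

(* Main.v *)
Require Import Defs.
From HB Require Import structures.
From mathcomp Require Import all_boot all_order all_algebra.
From mathcomp Require Import reals mpoly ssrcomplements.

Set Implicit Arguments.
Unset Strict Implicit.
Unset Printing Implicit Defensive.

Import Order.TTheory GRing.Theory Num.Theory.
Local Open Scope ring_scope.

(** Write d_j for the partial derivatives, T_j = (exp(h d_j) - 1) / h for the
    forward differences and Y_k = x_k exp(- h d_k), so that X_h is the sum of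
    the e_k Y_k.  The proof rests on the canonical commutation relation
    [T_j, Y_k] = delta_jk ([fdiff_X_coord]).  It propagates from the T_j to
    their monomials and hence to every power series g: [g(T), Y_k] is
    (dg/dy_k)(T) ([fps_op_canonical]).  As the real coefficients of g commute
    with the e_k, [g(T), X_h] is the sum of the e_k (dg/dy_k)(T)
    ([fps_op_X_op]).

    Take g = lambda and g = L = log lambda.  Since g |-> g(T) is multiplicative
    ([fps_op_mul]), the equations lambda dL/dy_k = dlambda/dy_k say that
      [lambda(T), X_h] = lambda(T) [L(T), X_h],
    which rearranges to lambda(T) Lambda_h = X_h lambda(T) ([sigma_fischer]).
    Moreover lambda(T) is sigma: Taylor's formula ([translateE]) gives
    T_j = v_j(d), where v_j = (exp(h y_j) - 1) / h, and substituting the v_j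
    into lambda before or after passing to operators gives the same result
    ([fps_op_subst]).

    The constant term of lambda is kappa(0)^n, which is nonzero, and all other
    terms of lambda(T) lower the degree.  So sigma is lambda(0) times the
    identity minus an operator that is nilpotent on each polynomial, and it is
    inverted by a Neumann series ([neumannK], [neumannVK]).  Finally
    sigma a = lambda(0) a for a constant a, and conjugating the k-th power of
    X_h gives the relation between the two sequences of polynomials.

    An operator g(T) applied to f is a sum over the multi-indices of degree
    less than any bound N >= msize f ([fps_opE]); identities between such
    operators are proved by choosing a bound that suits both sides. *)

(** * Sums over multi-indices of bounded degree *)

Section BoundedSums.
Variables (V : nmodType) (n : nat).
Implicit Types (F : 'X_{1..n} -> V) (k m : 'X_{1..n}).

(** Both sides run over the multi-indices k + m, up to terms that vanish; the
    two bounds are decoupled because products (N' = N) and derivatives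
    (N = N' + 1) shift the summation range differently. *)
Lemma sum_bmnm_shift k N N' F : (N <= mdeg k + N')%N ->
    (forall m, (N <= mdeg m)%N -> F m = 0) ->
  \sum_(m : 'X_{1..n < N} | (k <= m)%MM) F m
    = \sum_(m : 'X_{1..n < N'}) F (k + m)%MM.
Proof.
move=> leN F0; set M := (mdeg k + N')%N in leN.
rewrite (@eq_big_widen _ _ _ _ _ _ 'X_{1..n < N} 'X_{1..n < M}
  (fun m => k <= m)%MM F) /=; first last.
- by move=> m; rewrite -leqNgt => /F0.
- by move=> m ltN; apply: leq_trans leN.
pose shift (m : 'X_{1..n < N'}) := (k + m)%MM.
have shift_inj : injective shift by move=> m1 m2 /addmI/val_inj.
rewrite -(big_map shift xpredT) (big_mksub 'X_{1..n < M}) /=; first last.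
- by move=> _ /mapP[m _ ->]; rewrite mdegD ltn_add2l bmdeg.
- by rewrite map_inj_uniq ?index_enum_uniq.
apply: eq_bigl => m; apply/idP/mapP => [le_km|[m' _ ->]]; last exact: lem_addr.
have lt_m : (mdeg (m - k) < N')%N.
  by rewrite -(ltn_add2l (mdeg k)) addnC -mdegD submK ?bmdeg.
by exists (BMultinom lt_m); rewrite ?mem_index_enum // /shift /= addmC submK.
Qed.

Lemma sum_bmnm_widen N N' F : (N <= N')%N ->
    (forall m, (N <= mdeg m)%N -> F m = 0) ->
  \sum_(m : 'X_{1..n < N}) F m = \sum_(m : 'X_{1..n < N'}) F m.
Proof.
move=> leN F0; apply: (@eq_big_widen _ _ _ _ _ _
  'X_{1..n < N} 'X_{1..n < N'} xpredT F) => m.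
  by move=> ltN; apply: leq_trans leN.
by rewrite -leqNgt => /F0.
Qed.

End BoundedSums.

Lemma mdeg_le n (k m : 'X_{1..n}) : (k <= m)%MM -> (mdeg k <= mdeg m)%N.
Proof. by move/submK <-; rewrite mdegD leq_addl. Qed.

(** * Induction on polynomials *)

(** Identities between left-linear operators that satisfy a commutation rule
    with each 'X_k are best checked in this form. *)
Lemma mpoly_indMX (n : nat) (A : nzRingType) (Q : {mpoly A[n]} -> Prop) :
    (forall a, Q a%:MP) -> (forall p q, Q p -> Q q -> Q (p + q)) ->
    (forall k p, Q p -> Q ('X_k * p)) ->
  forall p, Q p.
Proof.
move=> QC QD QX; elim/mpolyind => [|a m p _ _ Qp]; first by rewrite -mpolyC0.
apply: QD => //; rewrite -mul_mpolyC commr_mpolyX mpolyXE_id.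
elim: (index_enum _) => [|k s IHs]; first by rewrite big_nil mul1r.
rewrite big_cons -mulrA; elim: (m k) => [|i IHi]; first by rewrite expr0 mul1r.
by rewrite exprS -mulrA; apply: QX.
Qed.

(** * Operators g(T) for commuting operators T lowering the degree *)

Section RealScale.
Variables (R : realType) (n : nat).
Local Notation Cl := (clifford R n).
Local Notation P := {mpoly Cl[n]}.
Implicit Types (f : P) (r : R).

Lemma cl_realE r : cl_real n r = in_alg Cl r.
Proof. by []. Qed.

Lemma cl_real_comm r (u : Cl) : cl_real n r * u = u * cl_real n r.
Proof. by rewrite /cl_real mulr_algl mulr_algr. Qed.

Lemma real_scale_is_linear r : linear (@real_scale R n r).
Proof. by move=> u f g; rewrite /real_scale scalerDr !scalerA cl_real_comm. Qed.

HB.instance Definition _ r :=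
  GRing.isLinear.Build Cl P P _ (@real_scale R n r) (real_scale_is_linear r).

Lemma real_scaleA r s f : real_scale r (real_scale s f) = real_scale (r * s) f.
Proof. by rewrite /real_scale scalerA !cl_realE -rmorphM. Qed.

Lemma real_scaleDl r s f :
  real_scale (r + s) f = real_scale r f + real_scale s f.
Proof. by rewrite /real_scale !cl_realE rmorphD scalerDl. Qed.

Lemma real_scale0 f : real_scale 0 f = 0.
Proof. by rewrite /real_scale cl_realE rmorph0 scale0r. Qed.

Lemma real_scale1 f : real_scale 1 f = f.
Proof. by rewrite /real_scale cl_realE rmorph1 scale1r. Qed.

Lemma real_scale_nat k f : real_scale k%:R f = f *+ k.
Proof. by rewrite /real_scale cl_realE rmorph_nat scaler_nat. Qed.

Lemma real_scale_suml (I : Type) (s : seq I) (Q : pred I) (r : I -> R) f :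
  real_scale (\sum_(i <- s | Q i) r i) f
    = \sum_(i <- s | Q i) real_scale (r i) f.
Proof. by rewrite /real_scale cl_realE rmorph_sum scaler_suml. Qed.

Lemma linear_real_scale (A : {linear P -> P}) r f :
  A (real_scale r f) = real_scale r (A f).
Proof. exact: linearZ. Qed.

Lemma msize_real_scale r f : (msize (real_scale r f) <= msize f)%N.
Proof. exact: msizeZ_le. Qed.

Lemma msize_sum_le (I : Type) (s : seq I) (Q : pred I) (F : I -> P) N :
    (forall i, Q i -> (msize (F i) <= N)%N) ->
  (msize (\sum_(i <- s | Q i) F i) <= N)%N.
Proof.
move=> leF; elim/big_ind: _ => [|f g lef leg|i Qi]; last exact: leF.
  by rewrite mmeasure0.
by apply: leq_trans (mmeasureD_le _ _ _) _; rewrite geq_max lef.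
Qed.

End RealScale.

Section FpsOp.
Variables (R : realType) (n : nat).
Local Notation Cl := (clifford R n).
Local Notation P := {mpoly Cl[n]}.
Implicit Types (f : P) (m k : 'X_{1..n}) (g u : fps R n).

Definition mnm_op (T : 'I_n -> {linear P -> P}) m f : P :=
  (\big[comp/id]_(j < n) iter (m j) (T j)) f.

Variable T : 'I_n -> {linear P -> P}.

Lemma mnm_op_is_linear m : linear (mnm_op T m).
Proof.
rewrite /mnm_op; elim: (index_enum _) => [|j s IHs] a f g.
  by rewrite big_nil.
rewrite big_cons /= IHs; elim: (m j) => [//|i /= ->]; exact: linearP.
Qed.

HB.instance Definition _ m :=
  GRing.isLinear.Build Cl P P _ (mnm_op T m) (mnm_op_is_linear m).

Lemma mnm_opU j f : mnm_op T U_(j) f = T j f.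
Proof.
have -> : T j f = iter (count_mem j (index_enum 'I_n)) (T j) f.
  by rewrite count_uniq_mem ?index_enum_uniq // mem_index_enum.
rewrite /mnm_op; elim: (index_enum _) => [|i s IHs]; first by rewrite big_nil.
by rewrite big_cons /= IHs mnm1E eq_sym iterD; case: eqP => [->|].
Qed.

Lemma mnm_op0 f : mnm_op T 0%MM f = f.
Proof.
rewrite /mnm_op; elim: (index_enum _) => [|i s IHs]; first by rewrite big_nil.
by rewrite big_cons /= mnm0E.
Qed.

Hypothesis T_lower : forall j f, (msize (T j f) <= (msize f).-1)%N.

Lemma msize_mnm_op m f : (msize (mnm_op T m f) <= msize f - mdeg m)%N.
Proof.
rewrite mdegE /mnm_op; elim: (index_enum _) => [|j s IHs].
  by rewrite !big_nil subn0.
rewrite !big_cons addnC subnDA /=.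
elim: (m j) => [|i IHi] /=; first by rewrite subn0.
by rewrite subnS; apply: leq_trans (T_lower _ _) _; rewrite -!subn1 leq_sub2r.
Qed.

Lemma mnm_op_eq0 m f : (msize f <= mdeg m)%N -> mnm_op T m f = 0.
Proof.
move=> le_fm; apply/eqP; rewrite -msize_poly_eq0 -leqn0.
by apply: leq_trans (msize_mnm_op m f) _; rewrite leqn0 subn_eq0.
Qed.

Lemma fps_opE N g f : (msize f <= N)%N ->
  fps_op T g f = \sum_(m : 'X_{1..n < N}) real_scale (g m) (mnm_op T m f).
Proof.
move=> leN.
apply: (sum_bmnm_widen (F := fun m => real_scale _ (mnm_op T m f))) => //.
by move=> m le_fm; rewrite mnm_op_eq0 // linear0.
Qed.

Lemma fps_op_is_linear g : linear (fps_op T g).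
Proof.
move=> a f1 f2.
pose N := maxn (msize (a *: f1 + f2)) (maxn (msize f1) (msize f2)).
rewrite !(@fps_opE N) ?leq_max ?leqnn ?orbT // scaler_sumr -big_split /=.
by apply: eq_bigr => m _; rewrite !linearP.
Qed.

Lemma fps_opD g f1 f2 : fps_op T g (f1 + f2) = fps_op T g f1 + fps_op T g f2.
Proof. by have := fps_op_is_linear g 1 f1 f2; rewrite !scale1r. Qed.

Lemma fps_opZ g a f : fps_op T g (a *: f) = a *: fps_op T g f.
Proof.
have f0 : fps_op T g 0 = 0.
  by have := fps_op_is_linear g (-1) 0 0; rewrite !scaleN1r !addNr.
by have := fps_op_is_linear g a f 0; rewrite !addr0 f0 addr0.
Qed.

Lemma fps_op_sum g (I : Type) (s : seq I) (F : I -> P) :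
  fps_op T g (\sum_(i <- s) F i) = \sum_(i <- s) fps_op T g (F i).
Proof.
elim: s => [|i s IHs]; last by rewrite !big_cons fps_opD IHs.
by rewrite !big_nil -(scale0r 0) fps_opZ !scale0r.
Qed.

Lemma fps_op_eq g u : g =1 u -> fps_op T g =1 fps_op T u.
Proof. by move=> E f; apply: eq_bigr => m _; rewrite E. Qed.

Lemma msize_fps_op d g f : (forall m, (mdeg m < d)%N -> g m = 0) ->
  (msize (fps_op T g f) <= msize f - d)%N.
Proof.
move=> g0; apply: msize_sum_le => m _; case: (ltnP (mdeg m) d) => [/g0->|le_dm].
  by rewrite real_scale0 mmeasure0.
apply: leq_trans (msize_real_scale _ _) _.
by apply: leq_trans (msize_mnm_op m f) _; rewrite leq_sub2l.
Qed.

Lemma fps_opC g a : fps_op T g a%:MP = real_scale (g 0%MM) a%:MP.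
Proof.
rewrite (@fps_opE 1) ?msizeC ?leq_b1 // (bigD1 bm0) //= mnm_op0.
rewrite big1 ?addr0 // => m; rewrite -val_eqE /= -mdeg_eq0 -lt0n => m_gt0.
by have := bmdeg m; rewrite ltnNge m_gt0.
Qed.

Hypothesis T_comm : forall i j f, T i (T j f) = T j (T i f).

Lemma mnm_opD m k f : mnm_op T (m + k) f = mnm_op T m (mnm_op T k f).
Proof.
have iterC j i a b f' :
    iter a (T i) (iter b (T j) f') = iter b (T j) (iter a (T i) f').
  have TC b' f'' : T i (iter b' (T j) f'') = iter b' (T j) (T i f'').
    by elim: b' => //= b' <-.
  by elim: a => //= a ->.
rewrite /mnm_op; elim: (index_enum _) f => [|j s IHs] f.
  by rewrite !big_nil.
rewrite !big_cons /= IHs mnmDE iterD; congr iter.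
move: (bigop _ _ _ f) => f'; elim: s {IHs} => [|i s IHs].
  by rewrite !big_nil.
by rewrite !big_cons /= iterC IHs.
Qed.

Lemma fps_op_comp N g u f : (msize f <= N)%N ->
  fps_op T g (fps_op T u f) = \sum_(k : 'X_{1..n < N})
    \sum_(m : 'X_{1..n < N}) real_scale (g k * u m) (mnm_op T (k + m) f).
Proof.
move=> leN; have le_uf : (msize (fps_op T u f) <= N)%N.
  by apply: leq_trans leN; rewrite -[X in (_ <= X)%N]subn0 msize_fps_op.
rewrite (fps_opE _ le_uf); apply: eq_bigr => k _.
rewrite (fps_opE _ leN) !linear_sum; apply: eq_bigr => m _.
by rewrite (linear_real_scale (mnm_op T k)) mnm_opD /= real_scaleA.
Qed.

Lemma fps_op_comm g u f : fps_op T g (fps_op T u f) = fps_op T u (fps_op T g f).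
Proof.
rewrite !(fps_op_comp _ _ (leqnn _)) exchange_big; apply: eq_bigr => k _ /=.
by apply: eq_bigr => m _; rewrite mulrC addmC.
Qed.

Lemma fps_op_mul g u f :
  fps_op T (fps_mul g u) f = fps_op T g (fps_op T u f).
Proof.
set N := msize f; rewrite (fps_op_comp _ _ (leqnn N)) (fps_opE _ (leqnn N)).
pose F k m := real_scale (g k * u (m - k)%MM) (mnm_op T m f).
transitivity (\sum_(m : 'X_{1..n < N})
    \sum_(k : 'X_{1..n < N} | (k <= m)%MM) F k m).
  apply: eq_bigr => m _; rewrite /fps_mul real_scale_suml.
  rewrite big_mkcond [RHS]big_mkcond.
  apply: (sum_bmnm_widen (F := fun k => if (k <= m)%MM then F k m else 0)).
    exact: bmdeg.
  move=> k; case: ifP => // /mdeg_le le_km lt_mk.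
  by have := leq_ltn_trans le_km lt_mk; rewrite ltnn.
rewrite (exchange_big_dep xpredT) //=; apply: eq_bigr => k _.
rewrite (sum_bmnm_shift (N' := N) (F := F k)) ?leq_addl // => [|m le_m].
  by apply: eq_bigr => m _; rewrite /F addmC addmK.
by rewrite /F mnm_op_eq0 ?linear0.
Qed.

(** The Y k are conjugate to the T j, as multiplication by the variables is to
    the partial derivatives; commutation with Y k then acts on power series
    in T as d/dy_k. *)
Section Canonical.
Variable Y : 'I_n -> {linear P -> P}.
Hypothesis Y_raise : forall (k : 'I_n) f, (msize (Y k f) <= (msize f).+1)%N.
Hypothesis T_Y : forall (j k : 'I_n) f,
  T j (Y k f) = Y k (T j f) + f *+ (j == k).

Lemma mnm_op_canonical m (k : 'I_n) f :
  mnm_op T m (Y k f) = Y k (mnm_op T m f) + mnm_op T (m - U_(k)) f *+ m k.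
Proof.
elim: {m}(mdeg m) {-2}m (erefl (mdeg m)) => [|d IHd] m.
  move/eqP; rewrite mdeg_eq0 => /eqP ->.
  by rewrite sub0m !mnm_op0 mnm0E mulr0n addr0.
move=> md; have [j mj] : exists j, (m j != 0)%N.
  apply/existsP; rewrite -[[exists _, _]]negbK negb_exists.
  apply/negP => /forallP m0; suff m0' : m = 0%MM by rewrite m0' mdeg0 in md.
  by apply/mnmP => i; have := m0 i; rewrite negbK mnm0E => /eqP.
have [m' Em] : exists m', m = (U_(j) + m')%MM.
  by exists (m - U_(j))%MM; rewrite addmC submK // lep1mP.
move: md; rewrite {m mj}Em mdegD mdeg1 add1n => -[/IHd IH].
rewrite !mnm_opD !mnm_opU IH linearD linearMn T_Y -addrA; congr (_ + _).
rewrite mnmDE mnm1E mulrnDr; case: eqVneq => [->|njk] /=.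
  rewrite addmC addmK; congr (_ + _); have [->//|mk] := eqVneq (m' k) 0%N.
  by rewrite -mnm_opU -mnm_opD addmC submK // lep1mP.
rewrite !mulr0n !add0r; have [->//|mk] := eqVneq (m' k) 0%N.
by rewrite -mnm_opU -mnm_opD addmBA // lep1mP.
Qed.

Lemma fps_op_canonical g (k : 'I_n) f :
  fps_op T g (Y k f) = Y k (fps_op T g f) + fps_op T (fps_deriv k g) f.
Proof.
(* Y k may raise the degree by one, so the bound N + 1 serves both sides; in
   the last term only the multi-indices m >= U_(k) contribute. *)
set N := msize f; rewrite (fps_opE _ (Y_raise k f)) (@fps_opE N.+1 _ f) //.
rewrite linear_sum.
have -> : fps_op T (fps_deriv k g) f = \sum_(m : 'X_{1..n < N.+1})
    real_scale (g m) (mnm_op T (m - U_(k)) f *+ m k).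
  rewrite (bigID (fun m : 'X_{1..n < N.+1} => U_(k) <= m)%MM) /=.
  rewrite [X in _ + X]big1 ?addr0 => [|m]; last first.
    by rewrite lep1mP negbK => /eqP ->; rewrite mulr0n linear0.
  rewrite (sum_bmnm_shift (N' := N)
    (F := fun m => real_scale (g m) (mnm_op T (m - U_(k)) f *+ m k))).
  - rewrite /fps_op; apply: eq_bigr => m _.
    rewrite /fps_deriv [(U_(k) + _)%MM]addmC addmK mnmDE mnm1E eqxx addn1.
    by rewrite -real_scale_nat real_scaleA mulrC.
  - by rewrite mdeg1.
  move=> m lt_m; rewrite mnm_op_eq0 ?mul0rn ?linear0 //.
  have [/submK Em|] := boolP (U_(k) <= m)%MM.
    by move: lt_m; rewrite -{1}Em mdegD mdeg1 addn1.
  rewrite lep1mP negbK => /eqP m0; rewrite [(m - _)%MM](_ : _ = m) 1?ltnW //.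
  apply/mnmP => i; rewrite mnmBE mnm1E.
  by case: eqP => [<-|]; rewrite ?m0 ?subn0.
rewrite -big_split; apply: eq_bigr => m _ /=.
by rewrite mnm_op_canonical linearD (linear_real_scale (Y k)).
Qed.

End Canonical.
End FpsOp.

(** * Substitution *)

Section Substitution.
Variables (R : realType) (n : nat).
Local Notation P := {mpoly (clifford R n)[n]}.
Variable T : 'I_n -> {linear P -> P}.
Hypothesis T_lower : forall j f, (msize (T j f) <= (msize f).-1)%N.
Hypothesis T_comm : forall i j f, T i (T j f) = T j (T i f).
Implicit Types (g u : fps R n) (f : P).

Lemma fps_op1 f : fps_op T (@fps_one R n) f = f.
Proof.
rewrite (fps_opE T_lower _ (leqnSn _)) (bigD1 bm0) //= mnm_op0.
rewrite big1 => [|m]; first by rewrite addr0 /fps_one eqxx real_scale1.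
by rewrite -val_eqE /= /fps_one => /negbTE ->; rewrite real_scale0.
Qed.

Lemma fps_op_exp g k f : fps_op T (fps_exp g k) f = iter k (fps_op T g) f.
Proof. by elim: k => [|k IHk] /=; rewrite ?fps_op1 // fps_op_mul // IHk. Qed.

Definition fps_order_ge (d : nat) g := forall m, (mdeg m < d)%N -> g m = 0.

Lemma fps_mul_order d e g u :
  fps_order_ge d g -> fps_order_ge e u -> fps_order_ge (d + e) (fps_mul g u).
Proof.
move=> g0 u0 m lt_m; rewrite /fps_mul big1 // => k le_km.
case: (ltnP (mdeg k) d) => [/g0 ->|le_dk]; first by rewrite mul0r.
rewrite u0 ?mulr0 // -(ltn_add2l (mdeg k)) addnC -mdegD submK //.
by apply: leq_trans lt_m _; rewrite leq_add2r.
Qed.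

Lemma fps_monomial_order (v : 'I_n -> fps R n) (k : 'X_{1..n}) :
    (forall j, v j 0%MM = 0) ->
  fps_order_ge (mdeg k)
    (\big[@fps_mul R n/@fps_one R n]_(j < n) fps_exp (v j) (k j)).
Proof.
move=> v0; rewrite mdegE; elim/big_ind2: _ => [//||j _].
  by move=> d1 g1 d2 g2; apply: fps_mul_order.
elim: (k j) => [//|i IHi] /=; rewrite -add1n; apply: fps_mul_order => // m.
by rewrite ltnS leqn0 mdeg_eq0 => /eqP ->.
Qed.

Variables (S : 'I_n -> {linear P -> P}) (v : 'I_n -> fps R n).
Hypothesis S_v : forall j f, S j f = fps_op T (v j) f.

Lemma fps_op_monomial (k : 'X_{1..n}) f :
  fps_op T (\big[@fps_mul R n/@fps_one R n]_(j < n) fps_exp (v j) (k j)) f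
    = mnm_op S k f.
Proof.
rewrite /mnm_op; elim/big_ind2: _ f => [|g1 A1 g2 A2 E1 E2|j _] f.
- exact: fps_op1.
- by rewrite fps_op_mul //= E2 E1.
- by rewrite fps_op_exp; elim: (k j) => //= i ->; rewrite S_v.
Qed.

(** Expand both sides over pairs (k, m), with k an exponent of g and m one of
    the product of the v j ^ k j.  The composition only keeps |k| <= |m|, which
    is harmless since that product has order at least |k|. *)
Lemma fps_op_subst g f : (forall j, v j 0%MM = 0) ->
  fps_op T (fps_comp g v) f = fps_op S g f.
Proof.
move=> v0; set N := msize f; rewrite (fps_opE T_lower _ (leqnn N)) /fps_op -/N.
set mono := fun k : 'X_{1..n} =>
  \big[@fps_mul R n/@fps_one R n]_(j < n) fps_exp (v j) (k j).
transitivity (\sum_(m : 'X_{1..n < N}) \sum_(k : 'X_{1..n < N})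
    real_scale (g k) (real_scale (mono k m) (mnm_op T m f))).
  apply: eq_bigr => m _; rewrite /fps_comp real_scale_suml.
  under eq_bigr do rewrite -real_scaleA.
  apply: (sum_bmnm_widen
    (F := fun k => real_scale (g k) (real_scale (mono k m) (mnm_op T m f)))).
    exact: bmdeg.
  by move=> k lt_mk; rewrite /mono fps_monomial_order // real_scale0 linear0.
rewrite exchange_big; apply: eq_bigr => k _ /=; rewrite -linear_sum /=.
by rewrite -(fps_opE T_lower _ (leqnn N)) fps_op_monomial.
Qed.

End Substitution.

(** * Operators that are the identity up to lower degree *)

Section Unipotent.
Variables (n : nat) (A : nzRingType).
Local Notation P := {mpoly A[n]}.
Implicit Types (f : P).
Variable K : {additive P -> P}.
Hypothesis K_lower : forall f, (msize (K f) <= (msize f).-1)%N.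

(** The inverse of id - K: iterates of order at least msize f kill f. *)
Definition neumann f : P := \sum_(i < msize f) iter i K f.

Lemma iter_lower_eq0 i f : (msize f <= i)%N -> iter i K f = 0.
Proof.
have size_iter : (msize (iter i K f) <= msize f - i)%N.
  elim: i => [|i IHi]; first by rewrite subn0.
  by rewrite subnS (leq_trans (K_lower _)) // -!subn1 leq_sub2r.
move=> le_fi; apply/eqP; rewrite -msize_poly_eq0 -leqn0.
by rewrite (leq_trans size_iter) // leqn0 subn_eq0.
Qed.

Lemma neumannE N f : (msize f <= N)%N -> neumann f = \sum_(i < N) iter i K f.
Proof.
move=> leN; rewrite /neumann -!(big_mkord xpredT (fun i => iter i K f)).
rewrite [RHS](big_cat_nat (leq0n _) leN) //= [X in _ + X]big_nat_cond.
by rewrite [X in _ + X]big1 ?addr0 // => i /andP[/andP[/iter_lower_eq0 ->]].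
Qed.

Lemma sum_iterB N f :
  \sum_(i < N) (iter i K f - iter i.+1 K f) = f - iter N K f.
Proof.
elim: N => [|N IHN]; first by rewrite big_ord0 subrr.
by rewrite big_ord_recr IHN /= addrA subrK.
Qed.

Lemma neumannK f : neumann (f - K f) = f.
Proof.
have leK : (msize (f - K f) <= msize f)%N.
  apply: leq_trans (mmeasureD_le _ _ _) _; rewrite mmeasureN geq_max leqnn.
  by apply: leq_trans (K_lower f) (leq_pred _).
have iterB i : iter i K (f - K f) = iter i K f - iter i.+1 K f.
  by rewrite iterSr; elim: i => //= i ->; rewrite raddfB.
rewrite (neumannE leK); under eq_bigr do rewrite iterB.
by rewrite sum_iterB iter_lower_eq0 ?subr0.
Qed.

Lemma neumannVK f : neumann f - K (neumann f) = f.
Proof.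
by rewrite raddf_sum -sumrB sum_iterB iter_lower_eq0 ?subr0.
Qed.

End Unipotent.

(** * Derivatives and translations *)

Section Translations.
Variables (R : realType) (n : nat).
Local Notation Cl := (clifford R n).
Local Notation P := {mpoly Cl[n]}.
Implicit Types (f g : P) (c h : R) (i j k : 'I_n).

Definition pderiv j : {linear P -> P} := mderiv j.

Lemma msize_pderiv j f : (msize (pderiv j f) <= (msize f).-1)%N.
Proof.
rewrite /= /mderiv big_seq_cond; apply: msize_sum_le => m /andP[fm _].
have [->|mj] := eqVneq (m j) 0%N; first by rewrite mul0r scale0r mmeasure0.
apply: leq_trans (msizeZ_le _ _) _; rewrite msizeX.
have /submK Em : (U_(j) <= m)%MM by rewrite lep1mP.
have := msize_mdeg_lt fm; rewrite -{1}Em mdegD mdeg1 addn1.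
by case: (msize f).
Qed.

Lemma pderiv_comm i j f : pderiv i (pderiv j f) = pderiv j (pderiv i f).
Proof. exact: mderiv_comm. Qed.

Definition mulX k f : P := 'X_k * f.

Lemma mulX_is_linear k : linear (mulX k).
Proof.
move=> a f g; rewrite /mulX mulrDr -!mul_mpolyC mulrA.
by rewrite -commr_mpolyX -mulrA.
Qed.

HB.instance Definition _ k :=
  GRing.isLinear.Build Cl P P _ (mulX k) (mulX_is_linear k).

Lemma msize_mulX k f : (msize (mulX k f) <= (msize f).+1)%N.
Proof.
rewrite [f in mulX k f]mpolyE linear_sum big_seq_cond.
apply: msize_sum_le => m /andP[fm _]; rewrite linearZ /= /mulX -mpolyXD.
apply: leq_trans (msizeZ_le _ _) _; rewrite msizeX mdegD mdeg1 ltnS.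
exact: msize_mdeg_lt.
Qed.

Lemma pderiv_mulX j k f :
  pderiv j (mulX k f) = mulX k (pderiv j f) + f *+ (j == k).
Proof.
rewrite /mulX /= mderivM mderivX mnm1E addrC; congr (_ + _).
rewrite eq_sym; case: eqP => [->|_]; last by rewrite scale0r mul0r.
by rewrite scale1r -[X in (X - _)%MM]add0m addmK mpolyX0 mul1r.
Qed.

Lemma translate_is_linear c j : linear (@translate R n c j).
Proof. by move=> a f g; rewrite /translate linearP. Qed.

HB.instance Definition _ c j :=
  GRing.isLinear.Build Cl P P _ (@translate R n c j) (translate_is_linear c j).

Lemma translateD c j f g :
  translate c j (f + g) = translate c j f + translate c j g.
Proof. exact: linearD. Qed.

Lemma translateC c j (a : Cl) : translate c j a%:MP = a%:MP.
Proof. exact: comp_mpolyC. Qed.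

Lemma translate_mulX c j k f : translate c j (mulX k f)
  = mulX k (translate c j f) + real_scale (c *+ (k == j)) (translate c j f).
Proof.
have commC (r : R) g : GRing.comm g (cl_real n r)%:MP.
  elim/mpoly_indMX: g => [a|p q Cp Cq|k' p Cp].
  - by rewrite /GRing.comm -!mpolyCM cl_real_comm.
  - exact/commr_sym/commrD/commr_sym/Cq/commr_sym.
  - apply/commr_sym/commrM/commr_sym/Cp; exact: commr_mpolyX.
set t := [tuple 'X_i + (if i == j then cl_real n c else 0)%:MP | i < n].
have comm_t i g : GRing.comm g (tnth t i).
  rewrite tnth_mktuple; apply: commrD; first exact: commr_mpolyX.
  by case: (i == j); [exact: commC | rewrite mpolyC0; apply: commr0].
have [tM _] : multiplicative (@comp_mpoly n Cl n t).
  apply: commr_mmap_is_multiplicative => // p m m'.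
  by rewrite /mmap1; apply: commr_prod => i _; apply/commrX/comm_t.
rewrite /translate -/t tM comp_mpolyXU -tnth_nth tnth_mktuple mulrDl.
congr (_ + _); rewrite mul_mpolyC /real_scale; congr (_ *: _).
by case: eqP; rewrite ?mulr1n // mulr0n cl_realE rmorph0.
Qed.

Definition translate_symbol c j : fps R n := fps_var j (egf (GRing.exp c)).

Lemma translate_symbol0 c j : translate_symbol c j 0%MM = 1.
Proof.
by rewrite /translate_symbol /fps_var mnm0E mulm0n eqxx /egf expr0 fact0 divr1.
Qed.

Lemma translate_symbol_deriv c j k :
  fps_deriv k (translate_symbol c j) =1
  fun m => (c *+ (k == j)) * translate_symbol c j m.
Proof.
move=> m; rewrite /fps_deriv /translate_symbol /fps_var.
have [->|nkj] := eqVneq k j; last first.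
  rewrite mulr0n mul0r; case: eqP => [/mnmP/(_ k)|]; last by rewrite mulr0.
  by rewrite mulmnE !mnmDE !mnm1E eqxx (eq_sym j) (negbTE nkj) addn1.
rewrite mnmDE mnm1E eqxx addn1 mulmSr eqm_add2r.
case: eqP => _; last by rewrite !mulr0.
rewrite /egf exprS factS natrM -mulf_div mulr1n [LHS]mulrA; congr (_ * _).
by rewrite mulrC divfK ?pnatr_eq0.
Qed.

(** Taylor's formula.  Both sides fix constants and commute with
    multiplication by 'X_k up to the same term: on the right, this is because
    d/dy_k exp(c y_j) is c delta_jk exp(c y_j). *)
Lemma translateE c j f :
  translate c j f = fps_op pderiv (translate_symbol c j) f.
Proof.
elim/mpoly_indMX: f => [a|f g Ef Eg|k f Ef].
- rewrite translateC (fps_opC (msize_pderiv)) translate_symbol0.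
  by rewrite real_scale1.
- by rewrite linearD /= Ef Eg (fps_opD msize_pderiv).
rewrite -/(mulX k f) translate_mulX Ef.
rewrite (fps_op_canonical msize_pderiv pderiv_comm msize_mulX pderiv_mulX).
rewrite (fps_op_eq _ (translate_symbol_deriv c j k)).
congr (_ + _); rewrite /fps_op linear_sum; apply: eq_bigr => m _ /=.
by rewrite real_scaleA.
Qed.

Lemma msize_translate c j f : (msize (translate c j f) <= msize f)%N.
Proof.
rewrite translateE -[X in (_ <= X)%N]subn0.
by apply: msize_fps_op => //; apply: msize_pderiv.
Qed.

Lemma translate_comm c c' i j f :
  translate c i (translate c' j f) = translate c' j (translate c i f).
Proof. by rewrite !translateE (fps_op_comm msize_pderiv pderiv_comm). Qed.

Lemma translateK c j : cancel (@translate R n (- c) j) (translate c j).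
Proof.
elim/mpoly_indMX => [a|f g Ef Eg|k f Ef]; first by rewrite !translateC.
  by rewrite (translateD (- c) j f g) translateD; apply: (congr2 +%R Ef Eg).
rewrite -/(mulX k f) (translate_mulX (- c) j k f).
move: (translate (- c) j f) Ef => g Eg; rewrite translateD translate_mulX Eg.
rewrite (linear_real_scale (translate c j)) /= Eg -addrA -real_scaleDl.
by rewrite mulNrn addrN real_scale0 addr0.
Qed.

Lemma fdiff_is_linear h j : linear (@fdiff R n h j).
Proof.
move=> a f g; rewrite /fdiff -real_scale_is_linear translate_is_linear.
by congr (real_scale _ _); rewrite scalerBr opprD addrACA.
Qed.

HB.instance Definition _ h j :=
  GRing.isLinear.Build Cl P P _ (@fdiff R n h j) (fdiff_is_linear h j).

Definition fdiff_lin h j : {linear P -> P} := fdiff h j.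

Lemma fdiff_symbol0 h j : fdiff_symbol h j 0%MM = 0 :> R.
Proof.
rewrite /fdiff_symbol /fps_var mnm0E mulm0n eqxx.
by rewrite /egf expr0 fact0 divr1 subrr mul0r.
Qed.

Lemma fdiffE h j f : fdiff_lin h j f = fps_op pderiv (fdiff_symbol h j) f.
Proof.
rewrite /fdiff_lin /= /fdiff translateE -[X in _ - X](fps_op1 msize_pderiv).
rewrite /fps_op -sumrB linear_sum; apply: eq_bigr => m _ /=.
rewrite /real_scale -scalerBl !cl_realE -rmorphB scalerA -rmorphM /=.
congr (_%:A *: _); rewrite /translate_symbol /fdiff_symbol /fps_var /fps_one.
rewrite mulrC; case: eqP => [Em|nEm]; last first.
  case: eqP nEm => [->|]; last by rewrite subrr mul0r.
  by rewrite mnm0E mulm0n.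
by congr ((_ - _%:R) / _); rewrite {1}Em -mdeg_eq0 mdegMn mdeg1 mul1n.
Qed.

Lemma msize_fdiff h j f : (msize (fdiff_lin h j f) <= (msize f).-1)%N.
Proof.
rewrite fdiffE -subn1; apply: (msize_fps_op msize_pderiv) => m.
by rewrite ltnS leqn0 mdeg_eq0 => /eqP ->; apply: fdiff_symbol0.
Qed.

Lemma fdiff_comm h i j f :
  fdiff_lin h i (fdiff_lin h j f) = fdiff_lin h j (fdiff_lin h i f).
Proof. by rewrite !fdiffE (fps_op_comm msize_pderiv pderiv_comm). Qed.

(** The operator conjugate to the forward difference in direction k: x_k alone
    would commute with it only up to a translation by h, which the backward
    translation undoes. *)
Definition X_coord h k f : P := mulX k (translate (- h) k f).

Lemma X_coord_is_linear h k : linear (X_coord h k).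
Proof. by move=> a f g; rewrite /X_coord !linearP. Qed.

HB.instance Definition _ h k :=
  GRing.isLinear.Build Cl P P _ (X_coord h k) (X_coord_is_linear h k).

Definition X_coord_lin h k : {linear P -> P} := X_coord h k.

Lemma msize_X_coord h k f : (msize (X_coord_lin h k f) <= (msize f).+1)%N.
Proof.
by apply: leq_trans (msize_mulX _ _) _; rewrite ltnS msize_translate.
Qed.

(** With E_j the translation by h and g the backward translate of f, the
    correction term is h^-1 * h * E_j g = f when j = k. *)
Lemma fdiff_X_coord h j k f : h != 0 ->
  fdiff_lin h j (X_coord_lin h k f)
    = X_coord_lin h k (fdiff_lin h j f) + f *+ (j == k).
Proof.
move=> h0; rewrite /= /X_coord.
have -> : translate (- h) k (fdiff h j f)
    = real_scale h^-1
        (translate h j (translate (- h) k f) - translate (- h) k f).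
  rewrite /fdiff (linear_real_scale (translate (- h) k)) /=.
  by rewrite [translate _ _ (_ - f)]linearB /= translate_comm.
have := translateK h k f; move: (translate (- h) k f) => g tg.
rewrite (linear_real_scale (mulX k)) /= /fdiff translate_mulX addrAC.
rewrite [real_scale _ (_ + _)]linearD /= [mulX k (_ - _)]linearB /=.
congr (_ + _); rewrite real_scaleA eq_sym; case: eqP => [->|_].
  by rewrite mulr1n mulVf // real_scale1 tg.
by rewrite !mulr0n mulr0 real_scale0.
Qed.

End Translations.

(** * The Fischer dual *)

Section FischerDual.
Variables (R : realType) (n : nat) (h : R).
Hypothesis h_neq0 : h != 0.
Local Notation P := {mpoly (clifford R n)[n]}.
Implicit Types (f : P) (g u lambda L : fps R n).
Local Notation D := (fps_op (@fdiff_lin R n h)).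

Lemma X_op_real_scale r f : X_op h (real_scale r f) = real_scale r (X_op h f).
Proof.
rewrite /X_op linear_sum; apply: eq_bigr => j _.
rewrite [RHS]linearZ; congr (_ *: _).
rewrite /= -!/(X_coord h j _). exact: (linear_real_scale (X_coord h j)).
Qed.

Lemma fps_op_X_op g f : D g (X_op h f)
  = X_op h (D g f) + \sum_(j < n) cl_gen R j *: D (fps_deriv j g) f.
Proof.
rewrite /X_op (fps_op_sum (@msize_fdiff _ _ h)) -big_split.
apply: eq_bigr => j _.
rewrite (fps_opZ (@msize_fdiff _ _ h)) /= -scalerDr; congr (_ *: _).
apply: (fps_op_canonical (@msize_fdiff _ _ h) (@fdiff_comm _ _ h)
          (@msize_X_coord _ _ h)) => i k f'.
exact: fdiff_X_coord.
Qed.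

Lemma sigma_opE lambda f : sigma_op h lambda f = D lambda f.
Proof.
apply: (fps_op_subst (@msize_pderiv _ _) (@pderiv_comm _ _)).
  exact: fdiffE.
exact: fdiff_symbol0.
Qed.

(** The intertwining relation, in a form that does not mention the inverse of
    sigma: lambda(T) [L(T), X_h] and [lambda(T), X_h] are both the sum of the
    e_j (dlambda/dy_j)(T). *)
Lemma sigma_fischer lambda L f : is_fps_log lambda L ->
  sigma_op h lambda (fischer_dual h L f) = X_op h (sigma_op h lambda f).
Proof.
move=> L_log; rewrite !sigma_opE /fischer_dual /commutator.
rewrite fps_op_X_op [X in _ - X]addrC addKr -scaleN1r.
rewrite (fps_opD (@msize_fdiff _ _ h)) (fps_opZ (@msize_fdiff _ _ h)).
rewrite fps_op_X_op (fps_op_sum (@msize_fdiff _ _ h)) scaleN1r -addrA -sumrB.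
rewrite big1 ?addr0 // => j _; apply/eqP; rewrite subr_eq0; apply/eqP.
rewrite (fps_opZ (@msize_fdiff _ _ h)); congr (_ *: _).
rewrite -(fps_op_mul (@msize_fdiff _ _ h) (@fdiff_comm _ _ h)).
by apply: fps_op_eq => m; rewrite L_log.
Qed.

Section Inverse.
Variable lambda : fps R n.
Hypothesis lambda0 : lambda 0%MM != 0.

(** sigma = lambda(0) (id - sigma_defect), and sigma_defect is a power series
    in the forward differences without constant term. *)
Definition sigma_defect f : P :=
  f - real_scale (lambda 0%MM)^-1 (sigma_op h lambda f).

Lemma sigma_defect_is_additive : additive sigma_defect.
Proof.
move=> f g; rewrite /sigma_defect !sigma_opE -scaleN1r.
rewrite (fps_opD (@msize_fdiff _ _ h)) (fps_opZ (@msize_fdiff _ _ h)) !scaleN1r.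
by rewrite linearB /= !opprD !opprK addrACA.
Qed.

HB.instance Definition _ :=
  GRing.isAdditive.Build P P sigma_defect sigma_defect_is_additive.

Lemma msize_sigma_defect f : (msize (sigma_defect f) <= (msize f).-1)%N.
Proof.
pose g m := fps_one R m - (lambda 0%MM)^-1 * lambda m.
have -> : sigma_defect f = D g f.
  rewrite /sigma_defect sigma_opE -{1}[f](fps_op1 (@msize_fdiff _ _ h)).
  rewrite /fps_op linear_sum -sumrB; apply: eq_bigr => m _ /=.
  by rewrite real_scaleA /real_scale -scalerBl !cl_realE -rmorphB.
rewrite -subn1; apply: (msize_fps_op (@msize_fdiff _ _ h)) => m.
rewrite ltnS leqn0 mdeg_eq0 => /eqP ->.
by rewrite /g /fps_one eqxx mulVf // subrr.
Qed.

Definition sigma_inv f : P :=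
  neumann sigma_defect (real_scale (lambda 0%MM)^-1 f).

Lemma sigma_opE_defect f :
  sigma_op h lambda f = real_scale (lambda 0%MM) (f - sigma_defect f).
Proof.
by rewrite /sigma_defect opprB addrC subrK real_scaleA mulfV // real_scale1.
Qed.

Lemma sigma_opK : cancel (sigma_op h lambda) sigma_inv.
Proof.
move=> f; rewrite /sigma_inv sigma_opE_defect real_scaleA mulVf // real_scale1.
exact: neumannK msize_sigma_defect f.
Qed.

Lemma sigma_invK : cancel sigma_inv (sigma_op h lambda).
Proof.
move=> f; rewrite sigma_opE_defect /sigma_inv.
by rewrite (neumannVK msize_sigma_defect) real_scaleA mulfV // real_scale1.
Qed.

Lemma sigma_inv_real_scale r f :
  sigma_inv (real_scale r f) = real_scale r (sigma_inv f).
Proof.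
apply: (can_inj sigma_opK); rewrite sigma_invK !sigma_opE.
by rewrite [RHS](fps_opZ (@msize_fdiff _ _ h)) -sigma_opE sigma_invK.
Qed.

End Inverse.
End FischerDual.

(** * Constant terms *)

Section ConstantTerms.
Variables (R : realType) (n : nat).
Implicit Types (g u : fps R n).

(** The sums defining the constant coefficient of a product or of a composition
    have a single index, 0; the bound is left in the form in which it occurs
    there. *)
Lemma sum_mdeg0 (F : 'X_{1..n} -> R) :
  \sum_(k : 'X_{1..n < (mdeg (0%MM : 'X_{1..n})).+1}) F k = F 0%MM.
Proof.
rewrite mdeg0 (bigD1 bm0) //= big1 ?addr0 // => k.
by rewrite -val_eqE /= -mdeg_eq0 -leqn0 -ltnS bmdeg.
Qed.

Lemma fps_mul_const g u : fps_mul g u 0%MM = g 0%MM * u 0%MM.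
Proof.
rewrite /fps_mul big_mkcond.
rewrite (sum_mdeg0 (fun k => if (k <= 0)%MM then g k * u (0 - k)%MM else 0)).
by rewrite lepm_refl sub0m.
Qed.

Lemma fps_prod_const (v : 'I_n -> fps R n) :
  (\big[@fps_mul R n/@fps_one R n]_(j < n) v j) 0%MM = \prod_(j < n) v j 0%MM.
Proof.
elim/big_ind2: _ => [|r1 g1 r2 g2 E1 E2|//]; first by rewrite /fps_one eqxx.
by rewrite fps_mul_const E1 E2.
Qed.

Lemma fps_comp_const g (v : 'I_n -> fps R n) : fps_comp g v 0%MM = g 0%MM.
Proof.
rewrite /fps_comp (sum_mdeg0 (fun k => g k *
  (\big[@fps_mul R n/@fps_one R n]_(j < n) fps_exp (v j) (k j)) 0%MM)).
by rewrite fps_prod_const big1 ?mulr1 // => j _; rewrite mnm0E /= /fps_one eqxx.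
Qed.

End ConstantTerms.

(** * Conjugation by sigma *)

Theorem proposition3p2 (R : realType) (n : nat) (n_ge1 : (1 <= n)%N)
    (h : R) (h_gt0 : 0 < h) (a : clifford R n)
    (mu : nat -> R)
    (c : nat -> R) (kappa0_neq0 : egf c 0 != 0)
    (lambda : fps R n)
    (lambda_kappa : fps_comp lambda (fdiff_symbol h)
       =1 \big[@fps_mul R n/@fps_one R n]_(j < n) fps_var j (egf c))
    (L : fps R n) (L_log : is_fps_log lambda L)
    (mu0 : mu 0%N = 1)
    (mu_appell : forall k : nat,
       dirac_fdiff h (power_poly mu (fischer_dual h L) a k.+1)
       = real_scale k.+1%:R (power_poly mu (fischer_dual h L) a k)) :
  exists sigmaV : {mpoly (clifford R n)[n]} -> {mpoly (clifford R n)[n]},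
    [/\ cancel (sigma_op h lambda) sigmaV,
        cancel sigmaV (sigma_op h lambda),
        forall f, fischer_dual h L f = sigmaV (X_op h (sigma_op h lambda f))
      & forall k : nat,
          power_poly mu (fischer_dual h L) a k
          = real_scale (lambda 0%MM) (sigmaV (power_poly mu (X_op h) a k))].
Proof.
have h0 : h != 0 by rewrite gt_eqF.
have sigmaC b : sigma_op h lambda b%:MP = real_scale (lambda 0%MM) b%:MP.
  by rewrite sigma_opE (fps_opC (@msize_fdiff _ _ h)).
have l0 : lambda 0%MM != 0.
  rewrite -(fps_comp_const lambda (fdiff_symbol h)) lambda_kappa fps_prod_const.
  by apply/prodf_neq0 => j _; rewrite /fps_var mnm0E mulm0n eqxx.
have sK := sigma_opK h l0; have sVK := sigma_invK h l0.
have fischerE f :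
    fischer_dual h L f = sigma_inv h lambda (X_op h (sigma_op h lambda f)).
  by rewrite -(sigma_fischer h0 f L_log) sK.
exists (sigma_inv h lambda); split=> // k; rewrite /power_poly.
have -> : iter k (fischer_dual h L) a%:MP
    = real_scale (lambda 0%MM) (sigma_inv h lambda (iter k (X_op h) a%:MP)).
  elim: k => [|k IHk] /=.
    by rewrite -(sigma_inv_real_scale h l0) -sigmaC sK.
  rewrite -(sigma_inv_real_scale h l0) in IHk.
  by rewrite IHk fischerE sVK X_op_real_scale (sigma_inv_real_scale h l0).
by rewrite (sigma_inv_real_scale h l0) !real_scaleA mulrC.
Qed.
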